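(* Let $\lambda>0$, $\alpha>0$, let $K$ be a random variable with values in $\{1,2,\dots\}$ and $\mathbb{E}[K^2]<\infty$, let $B$ be a nonnegative random variable with $\mathbb{E}[B]>0$ and $\mathbb{E}[B^2]<\infty$, and assume $\rho:=\lambda\mathbb{E}[K]\mathbb{E}[B]<1$. The function $$ f(x) = \rho\,\frac{\lambda\mathbb{E}[K]\mathbb{E}[B^2]}{2\mathbb{E}[B]} + \frac{\alpha \lambda\mathbb{E}[K]}{1-\rho}(1-x) + \rho\,\frac{\lambda^2\mathbb{E}[K]^2\mathbb{E}[B^2]}{1-\rho}(1-x) + \frac{\rho\,\mathbb{E}[K(K-1)]}{(1-\rho)\mathbb{E}[K]}(1-x) $$ is a solution of the integral equation $$ \begin{aligned} f(1-x) = \lambda\mathbb{E}[K]\bigg\{&\frac{\alpha}{\rho}\big[e^{\rho x} - 1\big] + \frac{\lambda\mathbb{E}[K]\,\mathbb{E}[B^2]}{2}\,e^{\rho x} + \mathbb{E}[B]\,\frac{\mathbb{E}[K(K-1)]}{\rho\,\mathbb{E}[K]}\big[e^{\rho x} - 1\big]\\ &+\int_{0}^x \mathbb{E}[B]\,e^{\rho(x-z)}f(z)\,\mathrm{d}z\bigg\},\qquad 0\le x<1, \end{aligned} $$ with boundary condition $$ \int_{0}^1 f(x)\,\mathrm{d}x = \frac{\lambda\mathbb{E}[K]}{2(1-\rho)}\Big(\alpha + \lambda\mathbb{E}[K]\mathbb{E}[B^2]+\mathbb{E}[B]\frac{\mathbb{E}[K(K-1)]}{\mathbb{E}[K]}\Big).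 $$
   Context: The parameters come from a polling system on a circle: $\lambda$ is the batch arrival rate, $K$ the batch size, $B$ the service time, $\alpha$ the time the server needs to travel once around the circle (circumference $1$) without stopping, and $\rho$ the load. The statement only concerns these numbers. *)

(* Defs.v *)
From HB Require Import structures.
From mathcomp Require Export all_boot all_order all_algebra.
From mathcomp Require Export all_classical all_reals all_analysis.

Set Implicit Arguments.
Unset Strict Implicit.
Unset Printing Implicit Defensive.

Import Order.TTheory GRing.Theory Num.Theory.
Import numFieldNormedType.Exports.

Local Open Scope classical_set_scope.
Local Open Scope ring_scope.

Section Polling.
Context (d : measure_display) (T : measurableType d) (R : realType).
Variable P : probability T R.

(* [fine] sends infinite values to 0: [mean X] is E[X] only when E[X] is
   finite, as is the case for all uses below once K and B have finite second
   moments. *)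
Definition mean (X : T -> R) : R := fine 'E_P[X].

Variables (lambda alpha : R) (K B : T -> R).

Definition load : R := lambda * mean K * mean B.

Definition mean_fact2 : R := mean (fun w => K w * (K w - 1)).

Definition mean_sq : R := mean (fun w => B w ^+ 2).

Definition polling_f (x : R) : R :=
  load * (lambda * mean K * mean_sq / (2 * mean B))
  + alpha * lambda * mean K / (1 - load) * (1 - x)
  + load * (lambda ^+ 2 * mean K ^+ 2 * mean_sq / (1 - load)) * (1 - x)
  + load * mean_fact2 / ((1 - load) * mean K) * (1 - x).

Definition solves_integral_equation (f : R -> R) : Prop :=
  forall x : R, 0 <= x < 1 ->
  f (1 - x) = lambda * mean K *
    (alpha / load * (expR (load * x) - 1)
     + lambda * mean K * mean_sq / 2 * expR (load * x)
     + mean B * (mean_fact2 / (load * mean K)) * (expR (load * x) - 1)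
     + \int[@lebesgue_measure R]_(z in `[0, x])
         (mean B * expR (load * (x - z)) * f z)).

Definition satisfies_boundary_condition (f : R -> R) : Prop :=
  \int[@lebesgue_measure R]_(x in `[0, 1]) f x =
  lambda * mean K / (2 * (1 - load)) *
    (alpha + lambda * mean K * mean_sq + mean B * (mean_fact2 / mean K)).

End Polling.

(* Main.v *)
Require Import Defs.
From mathcomp Require Import measurable_realfun ring lra.

Import Order.TTheory GRing.Theory Num.Theory.
Import numFieldNormedType.Exports.

Local Open Scope classical_set_scope.
Local Open Scope ring_scope.

(* The candidate is affine, [f z = c + D (1 - z)], so both integrals are
   elementary; the integrand [e^(rho (x - z)) f z] has the antiderivative
   [- e^(rho (x - z)) (c / rho + D ((1 - z) / rho - 1 / rho ^ 2))].  What is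
   left is a rational identity in the moments, in which the coefficient of
   [e^(rho x)] vanishes.  Finiteness of the second moments makes [E[K]] and
   [E[B]] finite, hence the denominators nonzero. *)

Lemma Rintegral_continuous_derive (R : realType) (F f : R -> R) (a b : R) :
  a <= b -> continuous f -> (forall x : R, is_derive x 1 F (f x)) ->
  \int[@lebesgue_measure R]_(x in `[a, b]) f x = F b - F a.
Proof.
(* [continuous_FTC2] asks for [a < b]; for [a = b] both sides are 0. *)
move=> ab cf dF; have [<-|neq_ab] := eqVneq a b.
  by rewrite set_itv1 Rintegral_set1 subrr.
have cF (x : R) : {for x, continuous F}.
  by apply/differentiable_continuous/derivable1_diffP; case: (dF x).
have lt_ab : a < b by rewrite lt_neqAle neq_ab.
rewrite /Rintegral (@continuous_FTC2 _ f F)//.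
- exact: continuous_subspaceT.
- split.
  + by move=> x _; case: (dF x).
  + exact: cvg_at_right_filter (cF a).
  + exact: cvg_at_left_filter (cF b).
- by move=> x _; rewrite derive1E; apply: derive_val.
Qed.

Lemma Rintegral_affine (R : realType) (c D : R) :
  \int[@lebesgue_measure R]_(z in `[0, 1]) (c + D * (1 - z)) = c + D / 2.
Proof.
pose F (z : R) := c * z - D / 2 * (1 - z) ^+ 2.
have dF (z : R) : is_derive z 1 F (c + D * (1 - z)).
  by rewrite /F; apply: is_derive_eq; rewrite /GRing.scale/=; field.
rewrite (@Rintegral_continuous_derive _ _ _ _ _ _ _ dF)//; first by rewrite /F; field.
by move=> z; apply/differentiable_continuous/derivable1_diffP/ex_derive.
Qed.

Lemma Rintegral_expR_affine (R : realType) (b r c D x : R) :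
  r != 0 -> 0 <= x ->
  \int[@lebesgue_measure R]_(z in `[0, x])
     (b * expR (r * (x - z)) * (c + D * (1 - z))) =
  b * (expR (r * x) * (c / r + D * (r^-1 - r ^- 2))
       - (c / r + D * ((1 - x) / r - r ^- 2))).
Proof.
move=> r0 x0.
pose F (z : R) :=
  - b * (expR (r * (x - z)) * (c / r + D * ((1 - z) / r - r ^- 2))).
(* The chain rule for the exponential factor is kept in the context, where the instance search that
   differentiates [F] can find it. *)
have dE (z : R) :
    is_derive z 1 (fun z => expR (r * (x - z))) (- r * expR (r * (x - z))).
  apply: is_derive_eq (is_derive1_comp (f := expR) _ _) _.
  by rewrite /GRing.scale/=; ring.
have dF (z : R) :
    is_derive z 1 F (b * expR (r * (x - z)) * (c + D * (1 - z))).
  by rewrite /F; apply: is_derive_eq; rewrite /GRing.scale/=; field.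
rewrite (@Rintegral_continuous_derive _ _ _ _ _ _ _ dF)//.
  by rewrite /F subrr mulr0 expR0 !subr0; field.
by move=> z; apply/differentiable_continuous/derivable1_diffP/ex_derive.
Qed.

(** Integrate [X <= 1 + X ^ 2] against a measure of total mass 1. *)
Lemma expectation_lty_of_sq (d : measure_display) (T : measurableType d)
    (R : realType) (P : probability T R) (X : {RV P >-> R}) :
  (forall w : T, 0 <= X w) -> ('E_P[(fun w : T => (X w ^+ 2)%R)] < +oo)%E ->
  ('E_P[X] < +oo)%E.
Proof.
move=> X0; rewrite unlock => X2.
have mX : measurable_fun setT X by [].
have mX2 : measurable_fun setT (fun w => X w ^+ 2).
  exact: measurable_funX.
apply: (@le_lt_trans _ _ (\int[P]_w (1%:E + (X w ^+ 2)%:E))%E).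
  apply: ge0_le_integral => //=.
  - by move=> w _; rewrite lee_fin.
  - exact/measurable_EFinP.
  - by apply: emeasurable_funD => //; exact/measurable_EFinP.
  - by move=> w _; rewrite -EFinD lee_fin; nra.
rewrite ge0_integralD//=; last 2 first.
- by move=> w _; rewrite lee_fin sqr_ge0.
- exact/measurable_EFinP.
rewrite integral_cst//= probability_setT mul1e.
by rewrite lte_add_pinfty// ltry.
Qed.

(** Since [fine] sends [+oo] to 0, a positive expectation gives a positive [mean] only once it is
    known to be finite; the second moment provides this. *)
Lemma mean_gt0 (d : measure_display) (T : measurableType d)
    (R : realType) (P : probability T R) (X : {RV P >-> R}) :
  (forall w : T, 0 <= X w) -> ('E_P[(fun w : T => (X w ^+ 2)%R)] < +oo)%E ->
  (0 < 'E_P[X])%E -> 0 < mean P X.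
Proof.
by move=> X0 X2 EX; apply: fine_gt0; rewrite EX expectation_lty_of_sq.
Qed.

Theorem proposition5 (d : measure_display) (T : measurableType d)
    (R : realType) (P : probability T R) (lambda alpha : R)
    (K B : {RV P >-> R})
    (lambda_gt0 : 0 < lambda)
    (alpha_gt0 : 0 < alpha)
    (K_pos_nat : forall w : T, exists2 n : nat, (0 < n)%N & K w = n%:R)
    (K_sq_fin : ('E_P[(fun w : T => (K w ^+ 2)%R)] < +oo)%E)
    (B_ge0 : forall w : T, 0 <= B w)
    (B_mean_gt0 : (0 < 'E_P[B])%E)
    (B_sq_fin : ('E_P[(fun w : T => (B w ^+ 2)%R)] < +oo)%E)
    (load_lt1 : load P lambda K B < 1) :
  solves_integral_equation P lambda alpha K B (polling_f P lambda alpha K B) /\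
  satisfies_boundary_condition P lambda alpha K B
    (polling_f P lambda alpha K B).
Proof.
have K_ge1 (w : T) : 1 <= K w.
  by have [n n0 ->] := K_pos_nat w; rewrite ler1n.
have EK_ge1 : (1 <= 'E_P[K])%E.
  rewrite -(expectation_cst P 1); apply: expectation_le => //.
  - by move=> w; exact: le_trans (K_ge1 w).
  - by apply/aeW => w; exact: K_ge1.
have K0 : 0 < mean P K.
  apply: mean_gt0 K_sq_fin (lt_le_trans _ EK_ge1) => //.
  by move=> w; exact: le_trans (K_ge1 w).
have B0 : 0 < mean P B by exact: mean_gt0.
have ld0 : 0 < load P lambda K B by rewrite !mulr_gt0.
pose c := load P lambda K B * (lambda * mean P K * mean_sq P B / (2 * mean P B)).
pose D := alpha * lambda * mean P K / (1 - load P lambda K B)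
  + load P lambda K B
    * (lambda ^+ 2 * mean P K ^+ 2 * mean_sq P B / (1 - load P lambda K B))
  + load P lambda K B * mean_fact2 P K / ((1 - load P lambda K B) * mean P K).
have fE : polling_f P lambda alpha K B = fun z => c + D * (1 - z).
  by apply/funext => z; rewrite /polling_f /c /D; ring.
have K_neq0 : mean P K != 0 by rewrite gt_eqF.
have B_neq0 : mean P B != 0 by rewrite gt_eqF.
have lambda_neq0 : lambda != 0 by rewrite gt_eqF.
(* Stated with [load] unfolded, the form in which [field] meets this denominator below. *)
have load_neq1 : 1 - lambda * mean P K * mean P B != 0.
  by rewrite gt_eqF// subr_gt0.
rewrite fE; split=> [x /andP[x0 _]|].
(* Write [r] for the load and [m] for [mean_fact2 P K]. As [lambda * E[K] * E[B] = r], the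
   coefficient of [expR (r * x)] vanishes and the constants match, both by [D * (1 - r) / r = 2 * c
   + alpha * lambda * E[K] / r + m / E[K]]. *)
- rewrite Rintegral_expR_affine ?gt_eqF// /c /D /load.
  by field; rewrite ?K_neq0 ?B_neq0 ?lambda_neq0 ?load_neq1.
(* In [c + D / 2], over the denominator [2 * (1 - r)] with [r] the load, the second moment of [B]
   enters with weight [1 - r] from [c] and [r] from [D]; the weights add up to 1. *)
- rewrite /satisfies_boundary_condition Rintegral_affine /c /D /load.
  by field; rewrite ?K_neq0 ?B_neq0 ?lambda_neq0 ?load_neq1.
Qed.
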